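(* Let $n\ge m$ be positive integers and let $f:\mathbb{R}^{m\times n}\to\mathbb{R}$ satisfy the standing assumptions listed in the context. Consider the preconditioned Nesterov iteration $$y_k=x_k+\beta(x_k-x_{k-1}),\qquad x_{k+1}=y_k-\alpha P_k^{-1}\nabla f(y_k),\qquad k\ge 0,$$ where the preconditioners $P_k\in\mathbb{R}^{m\times m}$ are symmetric positive definite and uniformly bounded, i.e. there are constants $p_{\max}>p_{\min}>0$ such that $p_{\min}I\preceq P_k\preceq p_{\max}I$ for all $k$. Then there exist a constant $\beta^*\in(0,1)$ and a positive function $\alpha^*:[0,\beta^* )\to\mathbb{R}_{>0}$ such that for every $\beta\in[0,\beta^* )$ and every $\alpha\in(0,\alpha^*(\beta))$ the generated sequence satisfies $$\lim_{k\to\infty}\|\nabla f(y_k)\|=0 .$$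
   Context: $\|\cdot\|$ and $\langle\cdot,\cdot\rangle$ denote the Frobenius norm and inner product on matrices, $\nabla f$ is the gradient with respect to this inner product, and $\preceq$ is the Loewner order. Standing assumptions on $f$ (for the problem of minimizing $f$ over $\mathbb{R}^{m\times n}$): $f$ is differentiable and $L$-smooth for some $L>0$, i.e. $\|\nabla f(x)-\nabla f(y)\|\le L\|x-y\|$ for all $x,y$; $f$ is proper, meaning that preimages of compact sets are compact; $f$ is bounded below and attains its minimum value $f^\star$ at some finite point; and $f$ satisfies a global Polyak-Łojasiewicz inequality with some constant $\mu>0$, i.e. $\|\nabla f(x)\|^2\ge\mu(f(x)-f^\star)$ for all $x\in\mathbb{R}^{m\times n}$. Conventions: $\alpha>0$ is the learning rate, $\beta\in[0,1)$ the momentum parameter; the matrices $P_k$ may vary with $k$ and may depend on the iterates; the bounds $p_{\min},p_{\max}$ are fixed before $\beta^*$ and $\alpha^*$, which may depend on $p_{\min},p_{\max}$ and $L$. The iteration starts from initial points $x_{-1},x_0\in\mathbb{R}^{m\times n}$. *)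

(* Defs.v *)
From HB Require Import structures.
From mathcomp Require Import all_boot all_order all_algebra.
From mathcomp Require Import all_classical all_reals all_analysis.

Set Implicit Arguments.
Unset Strict Implicit.
Unset Printing Implicit Defensive.

Import Order.TTheory GRing.Theory Num.Theory.
Import numFieldNormedType.Exports.

Local Open Scope classical_set_scope.
Local Open Scope ring_scope.

Section Frobenius.
Context {R : realType} {m n : nat}.
Implicit Types (A B x : 'M[R]_(m, n)) (f : 'M[R]_(m, n) -> R).

Definition frob_dot A B : R := \tr (A^T *m B).

(* The library norm `|A| on matrices is the max-norm, hence this one. *)
Definition frob_norm A : R := Num.sqrt (frob_dot A A).

(* The Riesz representative of the differential of f at x for the Frobenius
   inner product; see gradP and grad_unique.
   It is meaningful only where f is differentiable ('d f x is total). *)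
Definition grad f x : 'M[R]_(m, n) :=
  get [set g | forall h, 'd f x h = frob_dot g h].

Lemma frob_dotE A B : frob_dot A B = \sum_i \sum_j A i j * B i j.
Proof.
rewrite exchange_big; apply: eq_bigr => j _.
by rewrite mxE; apply: eq_bigr => i _; rewrite mxE.
Qed.

Lemma gradP f x h : 'd f x h = frob_dot (grad f x) h.
Proof.
suff : [set g | forall h, 'd f x h = frob_dot g h] (grad f x) by apply.
apply: getPex; exists (\matrix_(i, j) 'd f x (delta_mx i j)) => {}h.
rewrite [in LHS](matrix_sum_delta h) linear_sum frob_dotE.
apply: eq_bigr => i _; rewrite linear_sum; apply: eq_bigr => j _.
by rewrite linearZ mxE mulrC.
Qed.

Lemma grad_unique f x g :
  (forall h, 'd f x h = frob_dot g h) -> g = grad f x.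
Proof.
move=> gP; apply/matrixP => i j.
have dotd A : frob_dot A (delta_mx i j) = A i j.
  rewrite frob_dotE (bigD1 i)//= (bigD1 j)//= mxE !eqxx mulr1.
  rewrite !big1 ?addr0// => [i' /negbTE ni|j' /negbTE nj]; last first.
    by rewrite mxE nj andbF mulr0.
  by rewrite big1// => j' _; rewrite mxE ni mulr0.
by rewrite -dotd -gP gradP.
Qed.

End Frobenius.

Section Loewner.
Context {R : realType} {m : nat}.
Implicit Types A B : 'M[R]_m.

Definition posdefmx A :=
  A \is symmetricmx /\ forall v : 'cV[R]_m, v != 0 -> 0 < (v^T *m A *m v) 0 0.

Definition possemidefmx A :=
  A \is symmetricmx /\ forall v : 'cV[R]_m, 0 <= (v^T *m A *m v) 0 0.

Definition loewner_le A B := possemidefmx (B - A).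

End Loewner.

Section Optimization.
Context {R : realType} {m n : nat}.
Implicit Types (f : 'M[R]_(m, n) -> R) (L mu alpha beta : R).

Definition smooth_with f L :=
  forall x y, frob_norm (grad f x - grad f y) <= L * frob_norm (x - y).

Definition proper_map f := forall K : set R, compact K -> compact (f @^-1` K).

Definition infimum_value f : R := inf (range f).

Definition polyak_lojasiewicz f mu :=
  forall x, mu * (f x - infimum_value f) <= frob_norm (grad f x) ^+ 2.

Record standing_assumptions f L : Prop := StandingAssumptions {
  sa_differentiable : forall x, differentiable f x ;
  sa_smooth : smooth_with f L ;
  sa_proper : proper_map f ;
  sa_bounded_below : has_lbound (range f) ;
  sa_attains_min : exists x, f x = infimum_value f ;
  sa_pl : exists2 mu, 0 < mu & polyak_lojasiewicz f mu }.

(* xm1 is the extra initial point, the iterate of index -1. *)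
Definition nesterov_iterates f alpha beta (P : nat -> 'M[R]_m)
    (xm1 : 'M[R]_(m, n)) (x y : nat -> 'M[R]_(m, n)) :=
  forall k,
    y k = x k + beta *: (x k - (if k is j.+1 then x j else xm1)) /\
    x k.+1 = y k - alpha *: (invmx (P k) *m grad f (y k)).

End Optimization.

(* Main.v *)
Require Import Defs.
From HB Require Import structures.
From mathcomp Require Import all_boot all_order all_algebra.
From mathcomp Require Import all_classical all_reals all_analysis.
From mathcomp Require Import ring lra.

Set Implicit Arguments.
Unset Strict Implicit.
Unset Printing Implicit Defensive.

Import Order.TTheory GRing.Theory Num.Theory.
Import numFieldNormedType.Exports.

Local Open Scope classical_set_scope.
Local Open Scope ring_scope.

(** The proof is a descent argument for the energy

      E_k = f (x_k) + c |x_k - x_(k-1)|^2,   c = pmin^2 / (8 alpha pmax),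

    that is, the objective value plus a kinetic term. Write g for the gradient
    at y_k, d = x_k - x_(k-1) and W = P_k^-1 g, so that y_k = x_k + beta d and
    x_(k+1) = y_k - alpha W.

    L-smoothness bounds f both above and below by its linearization at y_k, up
    to a quadratic error (smooth_bound). Going from y_k to x_(k+1) lowers f by
    about alpha <g, W>, and going from x_k to y_k raises it by about
    beta <g, d>. The preconditioner costs only constants: the Loewner bounds
    give <g, W> >= |g|^2 / pmax and |W| <= |g| / pmin
    (loewner_le_cocoercive, loewner_ge_frob_sqr). The gain is therefore at
    least (alpha / pmax) |g|^2.

    The errors are multiples of |g|^2 and of |d|^2. Young's inequality turns
    beta <g, d> into a fraction of the gain plus (beta^2 pmax / alpha) |d|^2;
    the 1 / alpha here is what forces c to be of order 1 / alpha. The new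
    kinetic term contributes 2 c beta^2 |d|^2 + 2 c alpha^2 |W|^2, and the
    constant in c is such that its second half is again a fraction of the gain.
    What remains in front of |d|^2 is absorbed by the old kinetic term as soon
    as beta is small compared with pmin / pmax, independently of alpha. The
    smoothness errors are of higher order in alpha, which gives the bound on
    alpha. Altogether (nesterov_energy_step)

      E_(k+1) <= E_k - (alpha / (4 pmax)) |g|^2.

    Since f, hence E, is bounded below, E_k converges, its decrements tend to
    0, and so does |g| (cvg0_of_energy_decrease). *)

(** * The Frobenius inner product *)

Section FrobeniusTheory.
Context {R : realType} {m n : nat}.
Implicit Types (A B C : 'M[R]_(m, n)) (a : R).

Lemma frob_dotC A B : frob_dot A B = frob_dot B A.
Proof. by rewrite /frob_dot -mxtrace_tr trmx_mul trmxK. Qed.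

Lemma frob_dotDr A B C : frob_dot A (B + C) = frob_dot A B + frob_dot A C.
Proof. by rewrite /frob_dot mulmxDr mxtraceD. Qed.

Lemma frob_dotZr a A B : frob_dot A (a *: B) = a * frob_dot A B.
Proof. by rewrite /frob_dot -scalemxAr mxtraceZ. Qed.

Lemma frob_dotDl A B C : frob_dot (A + B) C = frob_dot A C + frob_dot B C.
Proof. by rewrite frob_dotC frob_dotDr !(frob_dotC C). Qed.

Lemma frob_dotZl a A B : frob_dot (a *: A) B = a * frob_dot A B.
Proof. by rewrite frob_dotC frob_dotZr frob_dotC. Qed.

Lemma frob_dotBl A B C : frob_dot (A - B) C = frob_dot A C - frob_dot B C.
Proof. by rewrite frob_dotDl -scaleN1r frob_dotZl mulN1r. Qed.

Lemma frob_dot_ge0 A : 0 <= frob_dot A A.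
Proof.
by rewrite frob_dotE; do 2!apply: sumr_ge0 => ? _; rewrite -expr2 sqr_ge0.
Qed.

Lemma frob_dot_eq0 A : frob_dot A A = 0 -> A = 0.
Proof.
rewrite frob_dotE => /eqP; rewrite psumr_eq0; last first.
  by move=> i _; apply: sumr_ge0 => j _; rewrite -expr2 sqr_ge0.
move=> /allP A0; apply/matrixP => i j; rewrite mxE.
have := A0 i (mem_index_enum _); rewrite /= psumr_eq0; last first.
  by move=> k _; rewrite -expr2 sqr_ge0.
by move=> /allP /(_ j (mem_index_enum _)) /=; rewrite mulf_eq0 orbb => /eqP.
Qed.

Lemma frob_norm_ge0 A : 0 <= frob_norm A.
Proof. exact: sqrtr_ge0. Qed.

Lemma sqr_frob_norm A : frob_norm A ^+ 2 = frob_dot A A.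
Proof. by rewrite sqr_sqrtr// frob_dot_ge0. Qed.

Lemma frob_normZ a A : 0 <= a -> frob_norm (a *: A) = a * frob_norm A.
Proof.
move=> a0; rewrite /frob_norm frob_dotZl frob_dotZr mulrA -expr2.
by rewrite sqrtrM ?sqr_ge0// sqrtr_sqr ger0_norm.
Qed.

(** Young's inequality with a free weight: the expansion of
    |a A - B|^2 >= 0, divided by a. *)
Lemma frob_young a A B :
  0 < a -> 2 * frob_dot A B <= a * frob_dot A A + a^-1 * frob_dot B B.
Proof.
move=> a0; have := frob_dot_ge0 (a *: A + (-1) *: B).
rewrite !(frob_dotDl, frob_dotDr, frob_dotZl, frob_dotZr) (frob_dotC B A) => h.
have -> : a * frob_dot A A + a^-1 * frob_dot B B =
    a^-1 * (a ^+ 2 * frob_dot A A + frob_dot B B).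
  by field; rewrite gt_eqF.
by rewrite mulrC ler_pdivlMl//; lra.
Qed.

Lemma frob_cauchy_schwarz A B : `|frob_dot A B| <= frob_norm A * frob_norm B.
Proof.
rewrite -ler_sqr ?nnegrE ?mulr_ge0 ?frob_norm_ge0//.
rewrite real_normK ?num_real// exprMn !sqr_frob_norm.
have [B0|B0] := eqVneq (frob_dot B B) 0.
  have -> := frob_dot_eq0 B0.
  by rewrite -(scale0r 0) !frob_dotZr !mul0r expr0n/= mulr0.
have Bgt0 : 0 < frob_dot B B by rewrite lt_def B0 frob_dot_ge0.
(* This vector is |B|^2 times the component of A orthogonal to B; its squared
   norm is |B|^2 (|A|^2 |B|^2 - <A, B>^2). *)
have := frob_dot_ge0 (frob_dot B B *: A + (- frob_dot A B) *: B).
rewrite !(frob_dotDl, frob_dotDr, frob_dotZl, frob_dotZr) (frob_dotC B A).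
set a := frob_dot A A; set b := frob_dot B B; set c := frob_dot A B => h.
rewrite -subr_ge0 -(pmulr_rge0 _ Bgt0) -/b.
by apply: le_trans h _; rewrite le_eqVlt; apply/orP; left; apply/eqP; ring.
Qed.

End FrobeniusTheory.

(** * Loewner bounds as inequalities for the Frobenius product *)

Section PreconditionerBounds.
Context {R : realType} {m : nat}.
Implicit Types (P : 'M[R]_m).

Lemma posdefmx_unit P : posdefmx P -> P \in unitmx.
Proof.
move=> [Psym Ppos]; rewrite -row_free_unit; apply: inj_row_free => v vP0.
apply/eqP; apply/negP => /negP v0.
have := Ppos v^T; rewrite trmxK vP0 mul0mx mxE ltxx.
suff -> : v^T != 0 by move/(_ isT).
by apply: contra_neq v0 => /(congr1 trmx); rewrite trmxK trmx0.
Qed.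

(** Left multiplication by P acts on each column separately, so <A, P A> is
    the sum over the columns v of A of the numbers v^T P v. *)
Lemma possemidefmx_frob_ge0 n P (A : 'M[R]_(m, n)) :
  possemidefmx P -> 0 <= frob_dot A (P *m A).
Proof.
move=> [_ Pge0]; rewrite /frob_dot; apply: sumr_ge0 => j _.
suff -> : (A^T *m (P *m A)) j j = ((col j A)^T *m P *m col j A) 0 0 by [].
rewrite -mulmxA !mxE; apply: eq_bigr => i _; rewrite !mxE; congr (_ * _).
by apply: eq_bigr => k _; rewrite !mxE.
Qed.

Lemma loewner_le_frob n P Q (A : 'M[R]_(m, n)) :
  loewner_le P Q -> frob_dot A (P *m A) <= frob_dot A (Q *m A).
Proof.
move=> /(possemidefmx_frob_ge0 A); rewrite mulmxBl -scaleN1r frob_dotDr.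
by rewrite frob_dotZr; lra.
Qed.

Lemma loewner_ge_coercive n P p (A : 'M[R]_(m, n)) :
  loewner_le p%:M P -> p * frob_dot A A <= frob_dot A (P *m A).
Proof. by move=> /(loewner_le_frob A); rewrite mul_scalar_mx frob_dotZr. Qed.

(** With A = P^-1 g this reads |P^-1 g| <= |g| / p. It combines coercivity,
    p |A|^2 <= <A, P A>, with Young's inequality for <A, P A>. *)
Lemma loewner_ge_frob_sqr n P p (A : 'M[R]_(m, n)) : 0 < p ->
  loewner_le p%:M P ->
  p ^+ 2 * frob_dot A A <= frob_dot (P *m A) (P *m A).
Proof.
move=> p0 /(loewner_ge_coercive A) coer.
have young := @frob_young _ _ _ p A (P *m A) p0.
have : p * frob_dot A A <= p^-1 * frob_dot (P *m A) (P *m A) by lra.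
by rewrite -ler_pdivrMl ?invr_gt0// invrK mulrA -expr2.
Qed.

(** With A = P^-1 g this reads <P^-1 g, g> >= |g|^2 / p. In spectral terms it is
    P^2 <= p P; it follows from the nonnegativity of the P-form at
    A - p^-1 P A, where the term <P A, P (P A)> is at most p |P A|^2. *)
Lemma loewner_le_cocoercive n P p (A : 'M[R]_(m, n)) : 0 < p ->
  posdefmx P -> loewner_le P p%:M ->
  p^-1 * frob_dot (P *m A) (P *m A) <= frob_dot A (P *m A).
Proof.
move=> p0 [Psym Ppos] lePp.
have Pge0 : possemidefmx P.
  split=> // v; have [->|v0] := eqVneq v 0; last exact: ltW (Ppos _ v0).
  by rewrite mulmx0 mxE.
have PT : P^T = P.
  by move: Psym => /is_hermitianmxP; rewrite expr0 scale1r map_mx_id.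
have adj (B C : 'M[R]_(m, n)) : frob_dot B (P *m C) = frob_dot (P *m B) C.
  by rewrite /frob_dot trmx_mul PT mulmxA.
have := possemidefmx_frob_ge0 (A - p^-1 *: (P *m A)) Pge0.
have := loewner_le_frob (P *m A) lePp; rewrite mul_scalar_mx frob_dotZr.
rewrite -scaleNr mulmxDr -scalemxAr.
rewrite !(frob_dotDl, frob_dotDr, frob_dotZl, frob_dotZr).
rewrite (adj A (P *m A)) (adj (P *m A) A).
rewrite (frob_dotC (P *m (P *m A)) A) (adj A (P *m A)).
set q := frob_dot A _; set N := frob_dot (P *m A) (P *m A).
set M := frob_dot _ (P *m (P *m A)) => h1 h2.
have h3 : p^-1 * (p^-1 * M) <= p^-1 * N.
  by rewrite ler_pM2l ?invr_gt0// mulrC ler_pdivrMr// mulrC.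
lra.
Qed.

End PreconditionerBounds.

(** * First-order expansion of a smooth function *)

Section DescentLemma.
Context {R : realType}.

(** One-dimensional descent lemma. The function psi of the proof, phi t
    minus dphi 0 * t and minus K t^2 / 2, has nonpositive derivative for
    t >= 0, so psi 1 <= psi 0 by the mean value theorem. *)
Lemma taylor1_le (phi dphi : R -> R) (K : R) :
  (forall t, is_derive t (1 : R) phi (dphi t)) ->
  (forall t, 0 <= t -> dphi t - dphi 0 <= K * t) ->
  phi 1 - phi 0 - dphi 0 <= K / 2.
Proof.
move=> dphiP dphi_lip.
pose psi t := phi t - dphi 0 * t - K / 2 * t ^+ 2.
have psiD t : is_derive t (1 : R) psi (dphi t - dphi 0 - K * t).
  have := dphiP t => ?; rewrite /psi.
  apply: is_derive_eq; rewrite /GRing.scale /=; lra.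
have := @MVT_segment R psi _ 0 1 ler01 (fun t _ => psiD t).
case.
  by apply: derivable_within_continuous => t _; have [] := psiD t.
move=> c.
rewrite in_itv/= subr0 mulr1 => /andP[c0 c1] psiE.
have := dphi_lip c c0; rewrite /psi in psiE; lra.
Qed.

Context {m n : nat}.
Variables (f : 'M[R]_(m, n) -> R) (L : R).
Hypothesis f_diff : forall x, differentiable f x.
Hypothesis f_smooth : smooth_with f L.

Lemma is_derive_along_line x v (t : R) :
  is_derive t (1 : R) (fun t : R => f (x + t *: v))
    (frob_dot (grad f (x + t *: v)) v).
Proof.
have f_diffx := f_diff (x + t *: v).
have slopeE :
  (fun h : R => h^-1 *: (((fun t => f (x + t *: v)) \o shift t) (h *: 1) -
                         f (x + t *: v))) =
  (fun h : R => h^-1 *: ((f \o shift (x + t *: v)) (h *: v) -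
                         f (x + t *: v))).
  apply/funext => h /=; congr (_ *: (f _ - _)).
  by rewrite /= [_ *: 1]mulr1 scalerDl addrCA.
split.
  by rewrite /derivable slopeE; exact: diff_derivable.
by rewrite /derive slopeE -[LHS]/('D_v f _) deriveE// gradP.
Qed.

(** Two-sided, because the energy estimate uses the upper bound from y_k to
    x_(k+1) and the lower bound from y_k to x_k, both linearized at y_k, the
    only point whose gradient enters the iteration. Both come from the
    restriction phi of f to the segment: taylor1_le is applied to phi and to
    - phi. *)
Lemma smooth_bound x v :
  `|f (x + v) - f x - frob_dot (grad f x) v| <= L / 2 * frob_dot v v.
Proof.
pose phi (t : R) := f (x + t *: v).
pose dphi (t : R) := frob_dot (grad f (x + t *: v)) v.
have dphi_lip t : 0 <= t -> `|dphi t - dphi 0| <= L * frob_dot v v * t.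
  move=> t0; rewrite /dphi scale0r addr0 -frob_dotBl.
  apply: le_trans (frob_cauchy_schwarz _ _) _.
  apply: le_trans (ler_wpM2r (frob_norm_ge0 _) (f_smooth _ _)) _.
  by rewrite addrAC subrr add0r frob_normZ// -sqr_frob_norm; lra.
have phiP t : is_derive t (1 : R) phi (dphi t) := is_derive_along_line x v t.
have lb_phi : - phi 1 - - phi 0 - - dphi 0 <= L * frob_dot v v / 2.
  apply: (@taylor1_le (fun t => - phi t) (fun t => - dphi t)).
  move=> t /dphi_lip; apply: le_trans.
  by rewrite -opprD -normrN ler_norm.
have ub_phi : phi 1 - phi 0 - dphi 0 <= L * frob_dot v v / 2.
  by apply: taylor1_le phiP _ => t /dphi_lip; apply: le_trans; exact: ler_norm.
move: lb_phi ub_phi; rewrite /phi /dphi scale1r scale0r addr0 -(mulrAC L).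
by rewrite ler_norml => lb ub; apply/andP; split; lra.
Qed.

End DescentLemma.

(** * The energy argument *)

(** An energy that is bounded below and decreasing converges, so its successive
    differences, which dominate c u_k^2, tend to 0. *)
Lemma cvg0_of_energy_decrease {R : realType} (E u : nat -> R) (c b : R) :
  0 < c -> (forall k, b <= E k) ->
  (forall k, E k.+1 <= E k - c * u k ^+ 2) -> (forall k, 0 <= u k) ->
  u k @[k --> \oo] --> (0 : R).
Proof.
move=> c0 E_ge E_dec u0.
have E_cvg : cvgn E.
  apply: nonincreasing_is_cvgn; last by exists b => _ [k _ <-].
  apply/nonincreasing_seqP => k; apply: le_trans (E_dec k) _.
  by rewrite gerBl mulr_ge0// ?sqr_ge0// ltW.
have dE : (E k - E k.+1) / c @[k --> \oo] --> (0 : R).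
  rewrite -[0 : R](mul0r c^-1) -[X in X * _](subrr (limn E)).
  apply: cvgMr_tmp; apply: cvgB => //.
  by rewrite cvg_shiftS.
have u2 : u k ^+ 2 @[k --> \oo] --> (0 : R).
  apply: squeeze_cvgr (cvg_cst 0) dE; near=> k.
  by rewrite sqr_ge0 ler_pdivlMr// mulrC; have := E_dec k; lra.
have -> : u = (fun k => Num.sqrt (u k ^+ 2)).
  by apply/funext => k; rewrite sqrtr_sqr ger0_norm.
rewrite -[0 : R]sqrtr0.
by apply: continuous_cvg u2; exact: sqrt_continuous.
Unshelve. all: by end_near.
Qed.

Section EnergyDecrease.
Context {R : realType} {m n : nat}.

(** One step of the iteration, with d = x_k - x_(k-1). In units of
    s = alpha / (4 pmax), the gain alpha <g, W> is at least 4 s |g|^2, and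
    three error terms cost s |g|^2 each: Young's inequality for beta <g, d>,
    the kinetic term in |W|^2, and the smoothness term in |W|^2. One s |g|^2 is
    left over. *)
Lemma nesterov_energy_step (f : 'M[R]_(m, n) -> R)
    (L pmin pmax alpha beta c : R) (P : 'M[R]_m) (x d y x' : 'M[R]_(m, n)) :
  (forall z, differentiable f z) -> smooth_with f L ->
  0 < L -> 0 < pmin -> pmin < pmax ->
  posdefmx P -> loewner_le pmin%:M P -> loewner_le P pmax%:M ->
  0 <= beta < pmin / (6 * pmax) ->
  0 < alpha < pmin ^+ 2 / (2 * L * pmax) ->
  y = x + beta *: d -> x' = y - alpha *: (invmx P *m grad f y) ->
  c = pmin ^+ 2 / (8 * alpha * pmax) ->
  f x' + c * frob_dot (x' - x) (x' - x) <=
  f x + c * frob_dot d d - alpha / (4 * pmax) * frob_norm (grad f y) ^+ 2.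
Proof.
move=> f_diff f_smooth L0 pmin0 ltp Ppos Pmin Pmax /andP[beta0 beta_lt]
  /andP[alpha0 alpha_lt] yE x'E cE.
have pmax0 : 0 < pmax := lt_trans pmin0 ltp.
rewrite sqr_frob_norm; set g := grad f y in x'E *.
set W := invmx P *m g in x'E.
have gE : g = P *m W by rewrite mulKVmx// posdefmx_unit.
have W_le : pmin ^+ 2 * frob_dot W W <= frob_dot g g.
  by rewrite gE; exact: loewner_ge_frob_sqr.
have gW_ge : pmax^-1 * frob_dot g g <= frob_dot g W.
  by rewrite (frob_dotC g) gE; exact: loewner_le_cocoercive.
have fy_le :
    f y - f x <= beta * frob_dot g d + L / 2 * (beta ^+ 2 * frob_dot d d).
  have := smooth_bound f_diff f_smooth y (- beta *: d).
  rewrite {1}yE scaleNr addrK -scaleNr !(frob_dotZl, frob_dotZr) -/g.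
  by rewrite ler_norml => /andP[+ _]; lra.
have fx'_le : f x' - f y <=
    - (alpha * frob_dot g W) + L / 2 * (alpha ^+ 2 * frob_dot W W).
  have := smooth_bound f_diff f_smooth y (- alpha *: W).
  rewrite scaleNr -x'E -scaleNr !(frob_dotZl, frob_dotZr) -/g.
  by rewrite ler_norml => /andP[_ +]; lra.
have kinetic_le : frob_dot (x' - x) (x' - x) <=
    2 * (beta ^+ 2 * frob_dot d d) + 2 * (alpha ^+ 2 * frob_dot W W).
  have -> : x' - x = beta *: d + (- alpha) *: W.
    by rewrite x'E yE scaleNr addrAC [x + _]addrC addrK.
  have := frob_dot_ge0 (beta *: d + alpha *: W).
  rewrite !(frob_dotDl, frob_dotDr, frob_dotZl, frob_dotZr); lra.
pose s := alpha / (4 * pmax).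
have s0 : 0 < s by rewrite divr_gt0// mulr_gt0.
(* The weight 2 s in Young's inequality makes the gradient part cost s |g|^2. *)
have young_gd : beta * frob_dot g d <=
    s * frob_dot g g + beta ^+ 2 * pmax / alpha * frob_dot d d.
  have := @frob_young _ _ _ (2 * s) g (beta *: d).
  rewrite mulr_gt0// => /(_ isT); rewrite !(frob_dotZl, frob_dotZr).
  have -> : (2 * s)^-1 = 2 * (pmax / alpha).
    by rewrite /s; field; rewrite !gt_eqF.
  lra.
move: W_le gW_ge fy_le fx'_le kinetic_le young_gd.
have := frob_dot_ge0 d; have := frob_dot_ge0 W; have := frob_dot_ge0 g.
set g2 := frob_dot g g; set w2 := frob_dot W W; set d2 := frob_dot d d.
set gw := frob_dot g W; set gd := frob_dot g d; set e2 := frob_dot (x' - x) _.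
move=> g20 w20 d20 W_le gW_ge fy_le fx'_le kinetic_le young_gd.
have c0 : 0 < c by rewrite cE divr_gt0 ?exprn_gt0// !mulr_gt0.
have gw_term : 4 * s * g2 <= alpha * gw.
  have -> : 4 * s * g2 = alpha * (pmax^-1 * g2).
    by rewrite /s; field; rewrite gt_eqF.
  by rewrite ler_pM2l.
have mom_w_term : c * (2 * (alpha ^+ 2 * w2)) <= s * g2.
  have -> : c * (2 * (alpha ^+ 2 * w2)) = s * (pmin ^+ 2 * w2).
    by rewrite cE /s; field; rewrite !gt_eqF.
  by rewrite ler_pM2l.
have alphaL : 2 * L * pmax * alpha <= pmin ^+ 2.
  by rewrite mulrC -ler_pdivlMr ?mulr_gt0//; exact: ltW.
have smooth_w_term : L / 2 * (alpha ^+ 2 * w2) <= s * g2.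
  have -> : L / 2 * (alpha ^+ 2 * w2) = s * (2 * L * pmax * alpha * w2).
    by rewrite /s; field; rewrite gt_eqF.
  by rewrite ler_pM2l//; apply: le_trans W_le; rewrite ler_wpM2r.
have betap : 36 * (beta ^+ 2 * pmax ^+ 2) <= pmin ^+ 2.
  have : 6 * (beta * pmax) <= pmin.
    by move/ltW: beta_lt; rewrite ler_pdivlMr ?mulr_gt0//; lra.
  have h0 : 0 <= 6 * (beta * pmax) by rewrite !mulr_ge0// ltW.
  by move=> h; have := lerXn2r 2 h0 (ltW pmin0) h; rewrite !exprMn; lra.
(* Multiplied by 8 alpha pmax, the right-hand side is pmin^2, and the three
   terms on the left are at most 2/36, 8/36 and 2/36 of pmin^2. *)
have d_coef :
    c * (2 * beta ^+ 2) + beta ^+ 2 * pmax / alpha + L / 2 * beta ^+ 2 <= c.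
  have beta_small : beta ^+ 2 <= 1 / 36.
    have p2 : pmin ^+ 2 <= pmax ^+ 2 by rewrite ler_sqr ?nnegrE ltW.
    have pp : 0 < pmax ^+ 2 by rewrite exprn_gt0.
    by rewrite -(ler_pM2r pp); lra.
  have h1 := ler_wpM2r (sqr_ge0 pmin) beta_small.
  have h2 := ler_wpM2r (sqr_ge0 beta) alphaL.
  have -> : c * (2 * beta ^+ 2) + beta ^+ 2 * pmax / alpha + L / 2 * beta ^+ 2 =
      (2 * (beta ^+ 2 * pmin ^+ 2) + 8 * (beta ^+ 2 * pmax ^+ 2) +
       4 * (L * pmax * alpha * beta ^+ 2)) / (8 * alpha * pmax).
    by rewrite cE; field; rewrite !gt_eqF.
  rewrite [leRHS]cE ler_pM2r ?invr_gt0 ?mulr_gt0//; have := sqr_ge0 pmin; lra.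
have d_term := ler_wpM2r d20 d_coef.
have := ler_wpM2l (ltW c0) kinetic_le; rewrite -/s; lra.
Qed.

End EnergyDecrease.

Theorem theorem3 (R : realType) (m n : nat) (L pmin pmax : R)
    (m_gt0 : (0 < m)%N) (le_mn : (m <= n)%N)
    (L_gt0 : 0 < L) (pmin_gt0 : 0 < pmin) (lt_pmin_pmax : pmin < pmax) :
  exists (beta_star : R) (alpha_star : R -> R),
    [/\ 0 < beta_star < 1,
        (forall beta : R, 0 <= beta < beta_star -> 0 < alpha_star beta)
      & forall f : 'M[R]_(m, n) -> R, standing_assumptions f L ->
        forall P : nat -> 'M[R]_m,
          (forall k, posdefmx (P k)) ->
          (forall k, loewner_le pmin%:M (P k) /\ loewner_le (P k) pmax%:M) ->
        forall beta : R, 0 <= beta < beta_star ->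
        forall alpha : R, 0 < alpha < alpha_star beta ->
        forall (xm1 : 'M[R]_(m, n)) (x y : nat -> 'M[R]_(m, n)),
          nesterov_iterates f alpha beta P xm1 x y ->
          frob_norm (grad f (y k)) @[k --> \oo] --> (0 : R)].
Proof.
have pmax_gt0 : 0 < pmax := lt_trans pmin_gt0 lt_pmin_pmax.
exists (pmin / (6 * pmax)), (fun=> pmin ^+ 2 / (2 * L * pmax)); split.
- rewrite divr_gt0 ?mulr_gt0//= ltr_pdivrMr ?mulr_gt0//; lra.
- by move=> _ _; rewrite divr_gt0 ?exprn_gt0// !mulr_gt0.
move=> f [f_diff f_smooth _ [b f_ge] _ _] P Ppos Pbounds beta beta_range alpha
  alpha_range xm1 x y iter.
have /andP[alpha_gt0 _] := alpha_range.
pose c := pmin ^+ 2 / (8 * alpha * pmax).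
pose d k := x k - (if k is j.+1 then x j else xm1).
apply: (@cvg0_of_energy_decrease _ (fun k => f (x k) + c * frob_dot (d k) (d k))
  _ (alpha / (4 * pmax)) b).
- by rewrite divr_gt0// mulr_gt0.
- move=> k; rewrite -[b]addr0 lerD//; first by apply: f_ge; exists (x k).
  by rewrite mulr_ge0 ?frob_dot_ge0// divr_ge0 ?exprn_ge0 ?mulr_ge0// ltW.
- move=> k; have [yE xE] := iter k; have [Pmin Pmax] := Pbounds k.
  exact: nesterov_energy_step f_diff f_smooth L_gt0 pmin_gt0 lt_pmin_pmax
    (Ppos k) Pmin Pmax beta_range alpha_range yE xE erefl.
- by move=> k; exact: frob_norm_ge0.
Qed.
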